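(* Let $x^*$ be a feasible point of the system (S) described in the context. If RCRCQ holds at $x^*$, then RCPLD holds at $x^*$.
   Context: Variational notions. For $C\subseteq\mathbb{R}^d$ and $z\in C$, $\widehat{\mathcal{N}}_C(z)=\{v:\langle v,z'-z\rangle\le o(\|z'-z\|)\ \forall z'\in C\}$ and the limiting normal cone is $\mathcal{N}_C(z)=\{\lim v_k:v_k\in\widehat{\mathcal{N}}_C(z_k),\ z_k\in C,\ z_k\to z\}$ (empty if $z\notin C$). For locally Lipschitz $f$, $\widehat\partial f(x)=\{\zeta:f(x')-f(x)-\langle\zeta,x'-x\rangle\ge o(\|x'-x\|)\}$ and the limiting subdifferential is $\partial f(x)=\{\lim\xi_k:\xi_k\in\widehat\partial f(x_k),\ x_k\to x\}$. System (S): $g_i(x)\le 0$ ($i=1,\dots,n$), $h_i(x)=0$ ($i=1,\dots,m$), $(G(x),H(x))\in\Omega^p$, $x\in C$, where $\Omega^p=\{(y,z)\in\mathbb{R}^p\times\mathbb{R}^p:0\le y\perp z\ge0\}$; $C=C_1\times\cdots\times C_l$ with $C_i\subseteq\mathbb{R}^{q_i}$ closed, $q_1+\cdots+q_l=d$ (points written $x=(x_1,\dots,x_l)$, $x_i\in\mathbb{R}^{q_i}$); $g_i:\mathbb{R}^d\to\mathbb{R}$ are locally Lipschitz and $h_i:\mathbb{R}^d\to\mathbb{R}$, $G,H:\mathbb{R}^d\to\mathbb{R}^p$ are continuously differentiable around $x^*$. Index sets at $x^*$: $I_g^*=\{i:g_i(x^* )=0\}$, $\mathcal{I}^*=\{i:0=G_i(x^*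 )<H_i(x^* )\}$, $\mathcal{J}^*=\{i:G_i(x^* )=H_i(x^* )=0\}$, $\mathcal{K}^*=\{i:G_i(x^* )>H_i(x^* )=0\}$. For $\eta_i\in\mathbb{R}^{q_i}$, the associated vector $\nu_i\in\mathbb{R}^d$ has $i$-th block $\eta_i$ and all other blocks $0$. Collections of vectors are treated as indexed families when speaking of rank and linear (in)dependence. RCRCQ holds at $x^*$ if for any index sets $\mathcal{I}_4\subseteq I_g^*$, $\mathcal{I}_5,\mathcal{I}_6\subseteq\mathcal{J}^*$, $\mathcal{L}\subseteq\{1,\dots,l\}$, any $v_i^*\in\partial g_i(x^* )$ ($i\in\mathcal{I}_4$), any $\eta_i^*\in\mathcal{N}_{C_i}(x_i^* )$ ($i\in\mathcal{L}$, with associated $\nu_i^*$), and all sequences $x^k\to x^*$, $x^k\neq x^*$, $v_i^k\in\partial g_i(x^k)$ with $v_i^k\to v_i^*$ ($i\in\mathcal{I}_4$), $\eta_i^k\in\mathcal{N}_{C_i}(x_i^k)$ with $\eta_i^k\to\eta_i^*$ ($i\in\mathcal{L}$, with associated $\nu_i^k$), for all sufficiently large $k$ the collections $$\{v_i^*\}_{i\in\mathcal{I}_4}\cup\{\nabla h_i(x^* )\}_{i=1}^m\cup\{\nabla G_i(x^* )\}_{i\in\mathcal{I}^*\cup\mathcal{I}_5}\cup\{\nabla H_i(x^* )\}_{i\in\mathcal{K}^*\cup\mathcal{I}_6}\cup\{\nu_i^*\}_{i\in\mathcal{L}}$$ and $$\{v_i^k\}_{i\in\mathcal{I}_4}\cup\{\nabla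 h_i(x^k)\}_{i=1}^m\cup\{\nabla G_i(x^k)\}_{i\in\mathcal{I}^*\cup\mathcal{I}_5}\cup\{\nabla H_i(x^k)\}_{i\in\mathcal{K}^*\cup\mathcal{I}_6}\cup\{\nu_i^k\}_{i\in\mathcal{L}}$$ have the same rank. RCPLD holds at $x^*$ if: (i) the vectors $\{\nabla h_i(x)\}_{i=1}^m\cup\{\nabla G_i(x)\}_{i\in\mathcal{I}^*}\cup\{\nabla H_i(x)\}_{i\in\mathcal{K}^*}$ have the same rank for all $x$ in a neighbourhood of $x^*$; (ii) let $\mathcal{I}_1\subseteq\{1,\dots,m\}$, $\mathcal{I}_2\subseteq\mathcal{I}^*$, $\mathcal{I}_3\subseteq\mathcal{K}^*$ be such that $\{\nabla h_i(x^* )\}_{i\in\mathcal{I}_1}\cup\{\nabla G_i(x^* )\}_{i\in\mathcal{I}_2}\cup\{\nabla H_i(x^* )\}_{i\in\mathcal{I}_3}$ is a basis of the span of the vectors in (i) at $x=x^*$. For any $\mathcal{I}_4\subseteq I_g^*$, $\mathcal{I}_5,\mathcal{I}_6\subseteq\mathcal{J}^*$: whenever there are $v_i^*\in\partial g_i(x^* )$ ($i\in\mathcal{I}_4$) and a nonzero vector $(\lambda^g,\lambda^h,\lambda^G,\lambda^H,\eta^* )\in\mathbb{R}^n\times\mathbb{R}^m\times\mathbb{R}^p\times\mathbb{R}^p\times\mathbb{R}^d$, whose components $\lambda_i^g,\lambda_i^h,\lambda_i^G,\lambda_i^H$ vanish for indices outside $\mathcal{I}_4,\ \mathcal{I}_1,\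 \mathcal{I}_2\cup\mathcal{I}_5,\ \mathcal{I}_3\cup\mathcal{I}_6$ respectively, with $\lambda_i^g\ge0$ for $i\in\mathcal{I}_4$, either $\lambda_i^G>0,\lambda_i^H>0$ or $\lambda_i^G\lambda_i^H=0$ for all $i\in\mathcal{J}^*$, $\eta^*=(\eta_1^*,\dots,\eta_l^* )\in\mathcal{N}_C(x^* )=\mathcal{N}_{C_1}(x_1^* )\times\cdots\times\mathcal{N}_{C_l}(x_l^* )$, and $$0=\sum_{i\in\mathcal{I}_4}\lambda_i^gv_i^*+\sum_{i\in\mathcal{I}_1}\lambda_i^h\nabla h_i(x^* )-\sum_{i\in\mathcal{I}_2\cup\mathcal{I}_5}\lambda_i^G\nabla G_i(x^* )-\sum_{i\in\mathcal{I}_3\cup\mathcal{I}_6}\lambda_i^H\nabla H_i(x^* )+\eta^*,$$ then for all sequences $x^k\to x^*$ with $x^k\ne x^*$, $v_i^k\in\partial g_i(x^k)$ with $v_i^k\to v_i^*$ ($i\in\mathcal{I}_4$), and $\eta^k=(\eta_1^k,\dots,\eta_l^k)\to\eta^*$ with $\eta_i^k\in\mathcal{N}_{C_i}(x_i^k)$ for all $i$, the vectors $$\{v_i^k\}_{i\in\mathcal{I}_4}\cup\{\nabla h_i(x^k)\}_{i\in\mathcal{I}_1}\cup\{\nabla G_i(x^k)\}_{i\in\mathcal{I}_2\cup\mathcal{I}_5}\cup\{\nabla H_i(x^k)\}_{i\in\mathcal{I}_3\cup\mathcal{I}_6}\cup\{\nu_i^k\}_{i\in L}$$ are linearly dependent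 for all sufficiently large $k$, where $L=\{i\in\{1,\dots,l\}:\eta_i^k\ne0\}$. *)

(* Defs.v *)
From HB Require Import structures.
From mathcomp Require Import all_boot all_order all_algebra.
From mathcomp Require Import all_classical all_reals all_analysis.

Set Implicit Arguments.
Unset Strict Implicit.
Unset Printing Implicit Defensive.

Import Order.TTheory GRing.Theory Num.Theory.
Import numFieldNormedType.Exports.

Local Open Scope classical_set_scope.
Local Open Scope ring_scope.

(* MathComp-Analysis equips ['rV[R]_d] with the sup norm.  It induces the usual
   topology, and notions such as [o(|z' - z|)] or local Lipschitz continuity
   are the same for the Euclidean norm. *)

Section variational_notions.
Variables (R : realType) (d : nat).
Implicit Types (C : set 'rV[R]_d) (f : 'rV[R]_d -> R) (u v x z xi : 'rV[R]_d).

Definition dotv u v : R := (u *m v^T) 0 0.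

Definition regular_normal_cone C z : set 'rV[R]_d :=
  [set v | C z /\ forall e : R, 0 < e ->
     \forall z' \near within C (nbhs z), dotv v (z' - z) <= e * `|z' - z|].

Definition limiting_normal_cone C z : set 'rV[R]_d :=
  [set v | C z /\ exists z_ v_ : nat -> 'rV[R]_d,
     [/\ forall k, C (z_ k) /\ regular_normal_cone C (z_ k) (v_ k),
         z_ @ \oo --> z & v_ @ \oo --> v]].

Definition regular_subdifferential f x : set 'rV[R]_d :=
  [set xi | forall e : R, 0 < e ->
     \forall x' \near x, f x' - f x - dotv xi (x' - x) >= - (e * `|x' - x|)].

Definition limiting_subdifferential f x : set 'rV[R]_d :=
  [set xi | exists x_ xi_ : nat -> 'rV[R]_d,
     [/\ forall k, regular_subdifferential f (x_ k) (xi_ k),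
         x_ @ \oo --> x & xi_ @ \oo --> xi]].

Definition locally_lipschitz f :=
  forall x, exists2 U : set 'rV[R]_d, nbhs x U & [lipschitz f y | y in U].

Definition gradient f x : 'rV[R]_d := \row_j 'd f x (delta_mx 0 j).

Definition C1_around f x :=
  \forall y \near x, differentiable f y /\ {for y, continuous (gradient f)}.

End variational_notions.

Definition complementarity_cone (R : realType) (p : nat) :
    set ('rV[R]_p * 'rV[R]_p) :=
  [set yz : 'rV[R]_p * 'rV[R]_p | [/\ forall i, 0 <= yz.1 0 i, dotv yz.1 yz.2 = 0
              & forall i, 0 <= yz.2 0 i]].
Arguments complementarity_cone : clear implicits.

(* [R^d] with [d = q_1 + ... + q_l] is ['rV[R]_(\sum_(i < l) q i)]; the [i]-th
   block of [x] is [submxrow x i]. *)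
Section block_structure.
Variables (R : realType) (l : nat) (q : 'I_l -> nat).

Definition prod_set (C : forall i, set 'rV[R]_(q i)) :
    set 'rV[R]_(\sum_(i < l) q i) :=
  [set x | forall i, C i (submxrow x i)].

(* The vector [nu_i] associated with [eta_i]: block [i] is [eta i], the other
   blocks are zero. *)
Definition assoc_vec (eta : forall i, 'rV[R]_(q i)) (i : 'I_l) :
    'rV[R]_(\sum_(i < l) q i) :=
  \mxrow_(j < l) (if j == i then eta j else 0).

End block_structure.

(* Finite collections of vectors, as indexed families, are sequences: the rank
   is [\dim << s >>] and linear independence, with multiplicities, is [free s]. *)
Definition rank (R : realType) (d : nat) (s : seq 'rV[R]_d) : nat :=
  (\dim << s >>)%VS.

Section constraint_system.
Variables (R : realType) (l : nat) (q : 'I_l -> nat) (n m p : nat).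
Local Notation d := (\sum_(i < l) q i)%N.
Variable C : forall i, set 'rV[R]_(q i).
Arguments C : clear implicits.
Variable g : 'I_n -> 'rV[R]_d -> R.
Variable h : 'I_m -> 'rV[R]_d -> R.
Variables G H : 'rV[R]_d -> 'rV[R]_p.
Implicit Types (x xs : 'rV[R]_d) (v : 'I_n -> 'rV[R]_d).
Implicit Type eta : forall i, 'rV[R]_(q i).

Definition coordinate (F : 'rV[R]_d -> 'rV[R]_p) (i : 'I_p) : 'rV[R]_d -> R :=
  fun x => F x 0 i.

Definition feasible x :=
  [/\ forall i, g i x <= 0, forall i, h i x = 0,
      complementarity_cone R p (G x, H x) & prod_set C x].

Definition active_g xs : {set 'I_n} := [set i | g i xs == 0]%SET.
Definition index_I xs : {set 'I_p} :=
  [set i | (G xs 0 i == 0) && (0 < H xs 0 i)]%SET.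
Definition index_J xs : {set 'I_p} :=
  [set i | (G xs 0 i == 0) && (H xs 0 i == 0)]%SET.
Definition index_K xs : {set 'I_p} :=
  [set i | (0 < G xs 0 i) && (H xs 0 i == 0)]%SET.

Definition gradients (Ah : {set 'I_m}) (AG AH : {set 'I_p}) x : seq 'rV[R]_d :=
  [seq gradient (h i) x | i <- enum Ah]
  ++ [seq gradient (coordinate G i) x | i <- enum AG]
  ++ [seq gradient (coordinate H i) x | i <- enum AH].

Definition collection (Ag : {set 'I_n}) (Ah : {set 'I_m})
    (AG AH : {set 'I_p}) (L : {set 'I_l}) v x eta : seq 'rV[R]_d :=
  [seq v i | i <- enum Ag] ++ gradients Ah AG AH x
  ++ [seq assoc_vec eta i | i <- enum L].

Definition RCRCQ xs :=
  forall (I4 : {set 'I_n}) (I5 I6 : {set 'I_p}) (L : {set 'I_l}),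
  I4 \subset active_g xs -> I5 \subset index_J xs -> I6 \subset index_J xs ->
  forall v eta,
  (forall i, i \in I4 -> limiting_subdifferential (g i) xs (v i)) ->
  (forall i, i \in L ->
     limiting_normal_cone (C i) (submxrow xs i) (eta i)) ->
  forall (x_ : nat -> 'rV[R]_d) (v_ : 'I_n -> nat -> 'rV[R]_d)
         (eta_ : forall i, nat -> 'rV[R]_(q i)),
  x_ @ \oo --> xs -> (forall k, x_ k <> xs) ->
  (forall i, i \in I4 ->
     (forall k, limiting_subdifferential (g i) (x_ k) (v_ i k)) /\
     v_ i @ \oo --> v i) ->
  (forall i, i \in L ->
     (forall k,
        limiting_normal_cone (C i) (submxrow (x_ k) i) (eta_ i k)) /\
     eta_ i @ \oo --> eta i) ->
  \forall k \near \oo,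
    rank (collection I4 [set: 'I_m]%SET (index_I xs :|: I5)%SET
            (index_K xs :|: I6)%SET L v xs eta)
    = rank (collection I4 [set: 'I_m]%SET (index_I xs :|: I5)%SET
            (index_K xs :|: I6)%SET L (v_^~ k) (x_ k) (fun i => eta_ i k)).

Definition RCPLD_i xs :=
  \forall x \near xs,
    rank (gradients [set: 'I_m]%SET (index_I xs) (index_K xs) x)
    = rank (gradients [set: 'I_m]%SET (index_I xs) (index_K xs) xs).

Definition RCPLD_ii xs :=
  forall (I1 : {set 'I_m}) (I2 I3 : {set 'I_p}),
  I2 \subset index_I xs -> I3 \subset index_K xs ->
  basis_of <<gradients [set: 'I_m]%SET (index_I xs) (index_K xs) xs>>%VS
           (gradients I1 I2 I3 xs) ->
  forall (I4 : {set 'I_n}) (I5 I6 : {set 'I_p}),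
  I4 \subset active_g xs -> I5 \subset index_J xs -> I6 \subset index_J xs ->
  forall v (lg : 'rV[R]_n) (lh : 'rV[R]_m) (lG lH : 'rV[R]_p)
         (eta : 'rV[R]_d),
  (forall i, i \in I4 -> limiting_subdifferential (g i) xs (v i)) ->
  (lg, lh, lG, lH, eta) <> 0 ->
  (forall i, i \notin I4 -> lg 0 i = 0) ->
  (forall i, i \notin I1 -> lh 0 i = 0) ->
  (forall i, i \notin (I2 :|: I5)%SET -> lG 0 i = 0) ->
  (forall i, i \notin (I3 :|: I6)%SET -> lH 0 i = 0) ->
  (forall i, i \in I4 -> 0 <= lg 0 i) ->
  (forall i, i \in index_J xs ->
     (0 < lG 0 i /\ 0 < lH 0 i) \/ lG 0 i * lH 0 i = 0) ->
  limiting_normal_cone (prod_set C) xs eta ->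
  0 = \sum_(i in I4) lg 0 i *: v i
      + \sum_(i in I1) lh 0 i *: gradient (h i) xs
      - \sum_(i in (I2 :|: I5)%SET) lG 0 i *: gradient (coordinate G i) xs
      - \sum_(i in (I3 :|: I6)%SET) lH 0 i *: gradient (coordinate H i) xs
      + eta ->
  forall (x_ : nat -> 'rV[R]_d) (v_ : 'I_n -> nat -> 'rV[R]_d)
         (eta_ : nat -> 'rV[R]_d),
  x_ @ \oo --> xs -> (forall k, x_ k <> xs) ->
  (forall i, i \in I4 ->
     (forall k, limiting_subdifferential (g i) (x_ k) (v_ i k)) /\
     v_ i @ \oo --> v i) ->
  eta_ @ \oo --> eta ->
  (forall k i, limiting_normal_cone (C i) (submxrow (x_ k) i)
                 (submxrow (eta_ k) i)) ->
  \forall k \near \oo,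
    ~~ free (collection I4 I1 (I2 :|: I5)%SET (I3 :|: I6)%SET
               [set i | submxrow (eta_ k) i != 0]%SET
               (v_^~ k) (x_ k) (fun i => submxrow (eta_ k) i)).

Definition RCPLD xs := RCPLD_i xs /\ RCPLD_ii xs.

End constraint_system.

(* Main.v *)
Require Import Defs.
From HB Require Import structures.
From mathcomp Require Import all_boot all_order all_algebra.
From mathcomp Require Import all_classical all_reals all_analysis.

(* For (i), apply RCRCQ with empty index sets to a sequence along which the rank
   would differ from its value at [xs].  For (ii), if the collection were free
   along a subsequence, one may assume that the set [L] of nonzero blocks of
   [eta_ k] is constant there, so that the blocks of [eta] outside [L] vanish.
   Then [eta] is the sum over [L] of its associated vectors, and the multipliers
   make the limit collection dependent: its span has dimension less than its
   size.  As [I1], [I2], [I3] give a basis, that span is also the span of the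
   full collection of RCRCQ at [xs], whereas the full collection at [x_ k] has
   rank at least the size of the free subcollection. *)

Set Implicit Arguments.
Unset Strict Implicit.
Unset Printing Implicit Defensive.

Import Order.TTheory GRing.Theory Num.Theory.
Import numFieldNormedType.Exports.

Local Open Scope classical_set_scope.
Local Open Scope ring_scope.

(** * Sequential criteria for properties that hold near a point or eventually *)

Lemma near_countable_base (T : Type) (F : set_system T) (B : nat -> set T) :
  Filter F -> (forall k, F (B k)) ->
  (forall A, F A -> \forall k \near \oo, B k `<=` A) ->
  forall P : set T,
  (forall s : nat -> T, s @ \oo --> F -> exists k, P (s k)) ->
  \forall y \near F, P y.
Proof.
move=> FF FB baseB P Pseq; apply: contrapT => nFP.
(* If [P] fails to hold near [F], every [B k] contains a point outside [P]. Such points form a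
   sequence converging to [F] that never meets [P]. *)
have /choice [s sP] : forall k, exists y, B k y /\ ~ P y.
  move=> k; apply: contrapT => noy; apply: nFP.
  apply: filterS (FB k) => y By; apply: contrapT => nPy.
  by apply: noy; exists y.
have [|k] := Pseq s; last by case: (sP k).
by move=> A /baseB; apply: filterS => k; apply; case: (sP k).
Qed.

(** Allows passing to a subsequence along which the negation of [P] holds at every index; [phi] need
    only tend to infinity, not increase. *)
Lemma near_infty_subseq (P : set nat) :
  (forall phi : nat -> nat, phi @ \oo --> \oo -> exists k, P (phi k)) ->
  \forall k \near \oo, P k.
Proof.
apply: (near_countable_base (B := fun k => [set j | (k <= j)%N])).
- exact: nbhs_infty_ge.
- by move=> A [N _ NA]; exists N => // k /= Nk j /= kj; apply/NA/(leq_trans Nk).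
Qed.

Lemma near_nbhs_seq (R : realType) (T : pseudoMetricType R) (x : T)
    (P : set T) :
  (forall s : nat -> T, s @ \oo --> x -> exists k, P (s k)) ->
  \forall y \near x, P y.
Proof.
apply: (near_countable_base (B := fun k : nat => ball x k.+1%:R^-1)).
- by move=> k; exact: nbhsx_ballx.
- move=> A /nbhs_ballP [e /= e0 eA].
  near=> k; apply: subset_trans eA; apply: le_ball; apply: ltW.
  by near: k; exact: (near_infty_natSinv_lt (PosNum e0)).
Unshelve. all: by end_near. Qed.

(** * Blocks of a vector and normal cones to products *)

Lemma dotv_sum_submxrow (R : realType) (l : nat) (q : 'I_l -> nat)
    (u v : 'rV[R]_(\sum_(j < l) q j)) :
  dotv u v = \sum_j dotv (submxrow u j) (submxrow v j).
Proof.
rewrite /dotv -[u in LHS]submxrowK -[v in LHS]submxrowK tr_mxrow.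
by rewrite mul_mxrow_mxcol summxE.
Qed.

Lemma mx_norm_le (R : realType) (a b : nat) (A : 'M[R]_(a, b)) (e : R) :
  0 <= e -> (forall i j, `|A i j| <= e) -> `|A| <= e.
Proof.
move=> e0 Ae; rewrite [leLHS]mx_normrE.
by apply: bigmax_le => // -[i j] _; exact: Ae.
Qed.

Lemma le_mx_norm (R : realType) (a b : nat) (A : 'M[R]_(a, b)) i j :
  `|A i j| <= `|A|.
Proof.
rewrite [leRHS]mx_normrE.
exact: (le_bigmax _ (fun ij : 'I_a * 'I_b => `|A ij.1 ij.2|) (i, j)).
Qed.

Lemma norm_submxrow_le (R : realType) (l : nat) (q : 'I_l -> nat)
    (u : 'rV[R]_(\sum_(j < l) q j)) i : `|submxrow u i| <= `|u|.
Proof. by apply: mx_norm_le => // a b; rewrite mxE le_mx_norm. Qed.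

Lemma norm_le_submxrow (R : realType) (l : nat) (q : 'I_l -> nat)
    (u : 'rV[R]_(\sum_(j < l) q j)) (e : R) :
  0 <= e -> (forall i, `|submxrow u i| <= e) -> `|u| <= e.
Proof.
move=> e0 ue; apply: mx_norm_le => // a b.
by rewrite -[u]submxrowK mxE (le_trans (le_mx_norm _ _ _)).
Qed.

Lemma submxrow_cvg (R : realType) (l : nat) (q : 'I_l -> nat) (i : 'I_l)
    (u_ : nat -> 'rV[R]_(\sum_(j < l) q j)) u :
  u_ @ \oo --> u ->
  (fun k => submxrow (u_ k) i : 'rV[R]_(q i)) @ \oo -->
  (submxrow u i : 'rV[R]_(q i)).
Proof.
move=> /cvgrPdist_le uu; apply/cvgrPdist_le => e /uu; apply: filterS => k.
by apply: le_trans; rewrite -submxrowB norm_submxrow_le.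
Qed.

(** It suffices to test the inequality for the product at points that differ from [z] in block [i]
    only. *)
Lemma regular_normal_cone_prod (R : realType) (l : nat) (q : 'I_l -> nat)
    (C : forall i, set 'rV[R]_(q i)) z v i :
  regular_normal_cone (prod_set C) z v ->
  regular_normal_cone (C i) (submxrow z i) (submxrow v i).
Proof.
move=> [Cz vz]; split=> [|e e0]; first exact: Cz.
have /nbhs_ballP [r /= r0 zr] := vz e e0; apply/nbhs_ballP.
exists r => //= y; rewrite -!ball_normE /= => yr Cy.
pose z' : 'rV[R]_(\sum_(j < l) q j) := \mxrow_j dfwith (submxrow z) i y j.
have z'i : submxrow (z' - z) i = y - submxrow z i.
  by rewrite submxrowB mxrowK dfwithin.
have z'j j : j != i -> submxrow (z' - z) j = 0.
  by rewrite eq_sym => ij; rewrite submxrowB mxrowK dfwithout// subrr.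
(* This bound serves twice: it keeps [z'] in the ball of radius [r], and it makes the error term one
   in [y]. *)
have z'z : `|z' - z| <= `|y - submxrow z i|.
  apply: norm_le_submxrow => // j.
  by have [->|/z'j->] := eqVneq j i; rewrite ?z'i// normr0.
have Cz' : prod_set C z' by move=> j; rewrite mxrowK; case: dfwithP.
have z'r : ball z r z'.
  by rewrite -ball_normE /= distrC (le_lt_trans z'z)// distrC.
have dotvE : dotv v (z' - z) = dotv (submxrow v i) (y - submxrow z i).
  rewrite dotv_sum_submxrow (bigD1 i)//= z'i [X in _ + X]big1 ?addr0//.
  by move=> j /z'j ->; rewrite /dotv trmx0 mulmx0 mxE.
rewrite -dotvE; apply: le_trans (zr z' z'r Cz') _.
by rewrite ler_wpM2l// ltW.
Qed.

(** Blocks of the approximating sequences approximate the blocks. This turns the normal [eta] of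
    RCPLD into the block normals that RCRCQ asks for. *)
Lemma limiting_normal_cone_prod (R : realType) (l : nat) (q : 'I_l -> nat)
    (C : forall i, set 'rV[R]_(q i)) z v i :
  limiting_normal_cone (prod_set C) z v ->
  limiting_normal_cone (C i) (submxrow z i) (submxrow v i).
Proof.
move=> [Cz [z_ [v_ [zv zz vv]]]]; split; first exact: Cz.
exists (fun k => submxrow (z_ k) i), (fun k => submxrow (v_ k) i).
split; [|exact: submxrow_cvg|exact: submxrow_cvg] => k.
have [Czk vk] := zv k.
by split; [exact: Czk|exact: regular_normal_cone_prod].
Qed.

(** Lets [eta] enter a linear dependence, as a combination of the [nu_i] with all coefficients 1. *)
Lemma sum_assoc_vec (R : realType) (l : nat) (q : 'I_l -> nat)
    (u : 'rV[R]_(\sum_(j < l) q j)) (L : {set 'I_l}) :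
  (forall i, i \notin L -> submxrow u i = 0) ->
  u = \sum_(i in L) assoc_vec (fun j => submxrow u j) i.
Proof.
move=> uL; apply/mxrowP => j; rewrite submxrow_sum.
under eq_bigr do rewrite mxrowK.
have [jL|jL] := boolP (j \in L).
  rewrite (bigD1 j)//= eqxx big1 ?addr0// => i /andP[_ ij].
  by rewrite eq_sym (negbTE ij).
by rewrite uL// big1// => i _; case: ifP.
Qed.

Lemma cat_subset (T : eqType) (X X' Y Y' : seq T) :
  {subset X <= X'} -> {subset Y <= Y'} -> {subset X ++ Y <= X' ++ Y'}.
Proof.
by move=> sX sY w; rewrite !mem_cat => /orP[/sX->|/sY->]//; rewrite orbT.
Qed.

(** * Linear independence and spans of indexed families *)

Section linear_algebra.
Variables (K : fieldType) (vT : vectType K).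
Implicit Types (X Y : seq vT).

Lemma free_map_enum (I : finType) (A : {set I}) (F : I -> vT) (c : I -> K) :
  free [seq F i | i <- enum A] -> \sum_(i in A) c i *: F i = 0 ->
  forall i, i \in A -> c i = 0.
Proof.
move=> /(@freeP _ _ _ (in_tuple _)) freeF sum0 i iA.
have szi : (index i (enum A) < size [seq F i | i <- enum A])%N.
  by rewrite size_map index_mem mem_enum.
(* [freeP] numbers coefficients by position in the list, so [c] is read through [enum A]; the
   default [i] is never reached. *)
have := freeF (fun j => c (nth i (enum A) j)).
move=> /(_ _ (Ordinal szi)) /=; rewrite nth_index ?mem_enum//; apply.
rewrite -[RHS]sum0 -[RHS]big_enum /= (big_nth i) big_mkord.
rewrite -(big_mkord xpredT (fun j => c (nth i (enum A) j) *:
  nth 0 [seq F i | i <- enum A] j)) size_map big_mkord.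
by apply: eq_bigr => j _; rewrite (nth_map i).
Qed.

(** The spans of two parts of a free family meet only in 0, and [y = - x] lies in both. *)
Lemma free_cat_eq0 X Y x y : free (X ++ Y) -> x \in <<X>>%VS ->
  y \in <<Y>>%VS -> x + y = 0 -> [/\ free X, free Y, x = 0 & y = 0].
Proof.
rewrite cat_free => /and3P[fX fY /directv_addP XY] xX yY /eqP.
rewrite addr_eq0 => /eqP xy.
suff y0 : y = 0 by rewrite xy y0 oppr0.
apply/eqP; rewrite -memv0 -XY memv_cap yY andbT.
by rewrite -[y]opprK -xy memvN.
Qed.

(** Peels off one part at a time, in the order [Xg], [Xe], [Xh], [XG]; the bracketing is that of
    [collection] and the signs are those of the dependence in RCPLD. *)
Lemma free_collection_cat_eq0 (Xg Xh XG XH Xe : seq vT) (sg sh sG sH se : vT) :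
  free (Xg ++ (Xh ++ XG ++ XH) ++ Xe) ->
  sg \in <<Xg>>%VS -> sh \in <<Xh>>%VS -> sG \in <<XG>>%VS ->
  sH \in <<XH>>%VS -> se \in <<Xe>>%VS -> 0 = sg + sh - sG - sH + se ->
  [/\ [/\ free Xg, free Xh, free XG & free XH],
      [/\ sg = 0, sh = 0, sG = 0 & sH = 0] & se = 0].
Proof.
move=> fr gX hX GX HX eX /esym sum0.
have {}sum0 : sg + ((sh + (- sG - sH)) + se) = 0 by rewrite -sum0 !addrA.
rewrite -memvN in GX; rewrite -memvN in HX.
have GHX := memv_add GX HX; rewrite -span_cat in GHX.
have hGHX := memv_add hX GHX; rewrite -span_cat in hGHX.
have heX := memv_add hGHX eX; rewrite -span_cat in heX.
have [fg fr1 sg0 sum1] := free_cat_eq0 fr gX heX sum0.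
have [fr2 _ sum2 se0] := free_cat_eq0 fr1 hGHX eX sum1.
have [fh fr3 sh0 sum3] := free_cat_eq0 fr2 hX GHX sum2.
have [fG fH /eqP sG0 /eqP sH0] := free_cat_eq0 fr3 GX HX sum3.
by split=> //; split=> //; apply/eqP; rewrite -oppr_eq0.
Qed.

Lemma sum_map_enum_span (I : finType) (A : {set I}) (F : I -> vT) (c : I -> K) :
  \sum_(i in A) c i *: F i \in <<[seq F i | i <- enum A]>>%VS.
Proof.
apply: memv_suml => i iA; apply/memvZ/memv_span/map_f.
by rewrite mem_enum.
Qed.

Lemma map_enum_subset (I : finType) (A B : {set I}) (F : I -> vT) :
  A \subset B -> {subset [seq F i | i <- enum A] <= [seq F i | i <- enum B]}.
Proof.
move=> /fintype.subsetP AB _ /mapP[i iA ->].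
by apply: map_f; move: iA; rewrite !mem_enum; exact: AB.
Qed.

End linear_algebra.

(** * The families of RCRCQ and RCPLD and their spans *)

Section collections.
Variables (R : realType) (l : nat) (q : 'I_l -> nat) (n m p : nat).
Local Notation d := (\sum_(i < l) q i)%N.
Variables (h : 'I_m -> 'rV[R]_d -> R) (G H : 'rV[R]_d -> 'rV[R]_p).
Implicit Types (x : 'rV[R]_d) (v : 'I_n -> 'rV[R]_d).
Implicit Types (Ag : {set 'I_n}) (Ah : {set 'I_m}) (AG AH : {set 'I_p}).
Implicit Types (L : {set 'I_l}) (eta : forall i, 'rV[R]_(q i)).

Lemma gradients_subset Ah Ah' AG AG' AH AH' x :
  Ah \subset Ah' -> AG \subset AG' -> AH \subset AH' ->
  {subset gradients h G H Ah AG AH x <= gradients h G H Ah' AG' AH' x}.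
Proof. by move=> sh sG sH; do 2?apply: cat_subset; exact: map_enum_subset. Qed.

Lemma collection_subset Ag Ah Ah' AG AG' AH AH' L v x eta :
  Ah \subset Ah' -> AG \subset AG' -> AH \subset AH' ->
  {subset collection h G H Ag Ah AG AH L v x eta
       <= collection h G H Ag Ah' AG' AH' L v x eta}.
Proof.
by move=> sh sG sH; do 2?apply: cat_subset => //; exact: gradients_subset.
Qed.

Lemma gradients_sub_collection Ag Ah AG AH L v x eta :
  {subset gradients h G H Ah AG AH x
       <= collection h G H Ag Ah AG AH L v x eta}.
Proof.
move=> w wg; rewrite /collection mem_cat [X in _ || X]mem_cat wg.
by rewrite orbT.
Qed.

Lemma collection_set0 Ah AG AH v x eta :
  collection h G H finset.set0 Ah (AG :|: finset.set0)%SET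
    (AH :|: finset.set0)%SET finset.set0 v x eta = gradients h G H Ah AG AH x.
Proof. by rewrite /collection !finset.setU0 !enum_set0 cat0s cats0. Qed.

Lemma gradients_setU_span Ah AG BG AH BH x (U : {vspace 'rV[R]_d}) :
  {subset gradients h G H Ah AG AH x <= U} ->
  {subset gradients h G H finset.set0 BG BH x <= U} ->
  {subset gradients h G H Ah (AG :|: BG)%SET (AH :|: BH)%SET x <= U}.
Proof.
move=> gA gB w; rewrite !mem_cat => /or3P[] wi.
- by apply: gA; rewrite mem_cat wi.
- move/mapP: wi => [i]; rewrite mem_enum finset.in_setU => /orP[] iA ->.
  + by apply: gA; rewrite !mem_cat; apply/or3P/Or32/map_f; rewrite mem_enum.
  + by apply: gB; rewrite !mem_cat; apply/or3P/Or32/map_f; rewrite mem_enum.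
- move/mapP: wi => [i]; rewrite mem_enum finset.in_setU => /orP[] iA ->.
  + by apply: gA; rewrite !mem_cat; apply/or3P/Or33/map_f; rewrite mem_enum.
  + by apply: gB; rewrite !mem_cat; apply/or3P/Or33/map_f; rewrite mem_enum.
Qed.

(** The gradients over all of ['I_m], [AG] and [AH] lie in the span of the basis gradients; all
    other vectors occur in both collections. *)
Lemma span_collection_basis Ag I1 I2 I3 I5 I6 AG AH L v x eta :
  <<gradients h G H I1 I2 I3 x>>%VS
    = <<gradients h G H [set: 'I_m]%SET AG AH x>>%VS ->
  (<<collection h G H Ag [set: 'I_m]%SET (AG :|: I5)%SET (AH :|: I6)%SET
       L v x eta>>
   <= <<collection h G H Ag I1 (I2 :|: I5)%SET (I3 :|: I6)%SET
          L v x eta>>)%VS.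
Proof.
move=> eq_span; set red := collection _ _ _ _ I1 _ _ _ _ _ _.
have sub_red (X : seq 'rV[R]_d) : {subset X <= red} -> {subset X <= <<red>>%VS}.
  by move=> Xred w /Xred; exact: memv_span.
have grad_red Ah (A B : {set 'I_p}) :
    Ah \subset I1 -> A \subset (I2 :|: I5)%SET ->
    B \subset (I3 :|: I6)%SET ->
    {subset gradients h G H Ah A B x <= red}.
  move=> s1 sA sB w /(gradients_subset s1 sA sB).
  exact: gradients_sub_collection.
apply/span_subvP => w; rewrite mem_cat [X in _ || X]mem_cat => /or3P[]; move: w.
- by apply: sub_red => w wv; rewrite mem_cat wv.
- apply: gradients_setU_span.
  + move=> w /memv_span; rewrite -eq_span; apply/subvP/sub_span.
    by apply: grad_red; rewrite ?finset.subsetUl.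
  + apply: sub_red; apply: grad_red; rewrite ?finset.subsetUr//.
    exact: finset.sub0set.
- by apply: sub_red => w wv; rewrite !mem_cat wv !orbT.
Qed.

(** Freeness makes each of the five terms vanish. For the first four this kills the coefficients,
    while the fifth is [eta] itself. *)
Lemma free_collection_eq0 Ag Ah AG AH L v x (eta : 'rV[R]_d)
    (lg : 'rV[R]_n) (lh : 'rV[R]_m) (lG lH : 'rV[R]_p) :
  free (collection h G H Ag Ah AG AH L v x (fun i => submxrow eta i)) ->
  (forall i, i \notin L -> submxrow eta i = 0) ->
  (forall i, i \notin Ag -> lg 0 i = 0) ->
  (forall i, i \notin Ah -> lh 0 i = 0) ->
  (forall i, i \notin AG -> lG 0 i = 0) ->
  (forall i, i \notin AH -> lH 0 i = 0) ->
  0 = \sum_(i in Ag) lg 0 i *: v i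
      + \sum_(i in Ah) lh 0 i *: gradient (h i) x
      - \sum_(i in AG) lG 0 i *: gradient (coordinate G i) x
      - \sum_(i in AH) lH 0 i *: gradient (coordinate H i) x
      + eta ->
  (lg, lh, lG, lH, eta) = 0.
Proof.
move=> fr eta0 lg0 lh0 lG0 lH0.
have row0 k (A : {set 'I_k}) (F : 'I_k -> 'rV[R]_d) (c : 'rV[R]_k) :
    free [seq F i | i <- enum A] -> (forall i, i \notin A -> c 0 i = 0) ->
    \sum_(i in A) c 0 i *: F i = 0 -> c = 0.
  move=> fF cA sum0; apply/rowP => i; rewrite mxE.
  have [iA|/cA//] := boolP (i \in A).
  exact: (free_map_enum fF sum0).
have etaL : eta \in <<[seq assoc_vec (fun j => submxrow eta j) i
    | i <- enum L]>>%VS.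
  rewrite {1}(sum_assoc_vec eta0).
  by apply: memv_suml => i iL; apply/memv_span/map_f; rewrite mem_enum.
move=> sum0.
have [[fg fh fG fH] [sg0 sh0 sG0 sH0] ->] := free_collection_cat_eq0 fr
  (sum_map_enum_span Ag v (fun i => lg 0 i))
  (sum_map_enum_span Ah (fun i => gradient (h i) x) (fun i => lh 0 i))
  (sum_map_enum_span AG (fun i => gradient (coordinate G i) x)
    (fun i => lG 0 i))
  (sum_map_enum_span AH (fun i => gradient (coordinate H i) x)
    (fun i => lH 0 i))
  etaL sum0.
rewrite (row0 _ _ _ _ fg lg0 sg0) (row0 _ _ _ _ fh lh0 sh0).
by rewrite (row0 _ _ _ _ fG lG0 sG0) (row0 _ _ _ _ fH lH0 sH0).
Qed.

End collections.

(** * Derivation of the two conditions of RCPLD *)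

Theorem proposition4p1 (R : realType) (l : nat) (q : 'I_l -> nat) (n m p : nat)
    (C : forall i : 'I_l, set 'rV[R]_(q i))
    (g : 'I_n -> 'rV[R]_(\sum_(i < l) q i) -> R)
    (h : 'I_m -> 'rV[R]_(\sum_(i < l) q i) -> R)
    (G H : 'rV[R]_(\sum_(i < l) q i) -> 'rV[R]_p)
    (xs : 'rV[R]_(\sum_(i < l) q i))
    (C_closed : forall i, closed (C i))
    (g_lip : forall i, locally_lipschitz (g i))
    (h_C1 : forall i, C1_around (h i) xs)
    (G_C1 : forall i, C1_around (coordinate G i) xs)
    (H_C1 : forall i, C1_around (coordinate H i) xs)
    (xs_feasible : feasible C g h G H xs) :
  RCRCQ C g h G H xs -> RCPLD C g h G H xs.
Proof.
move=> rcrcq; split.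
  apply: near_nbhs_seq => x_ x_xs; apply: contrapT => no_k.
  have {}no_k k : rank (gradients h G H [set: 'I_m]%SET (index_I G H xs)
      (index_K G H xs) (x_ k)) <> rank (gradients h G H [set: 'I_m]%SET
      (index_I G H xs) (index_K G H xs) xs).
    by move=> rk; apply: no_k; exists k.
  (* RCRCQ only speaks of sequences avoiding [xs]; here the differing rank ensures this. *)
  have x_neq k : x_ k <> xs by move=> xk; apply: (no_k k); rewrite xk.
  have := rcrcq finset.set0 finset.set0 finset.set0 finset.set0
    (finset.sub0set _) (finset.sub0set _) (finset.sub0set _)
    (fun=> 0) (fun=> 0) _ _ x_ (fun _ _ => 0) (fun _ _ => 0) x_xs x_neq.
  case=> [||||N _ /(_ N (leqnn N))]; try by move=> i; rewrite finset.in_set0.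
  rewrite !collection_set0 => /esym.
  exact: (no_k N).
move=> I1 I2 I3 sI2 sI3 /andP[/eqP span_basis _] I4 I5 I6 sI4 sI5 sI6.
move=> v lg lh lG lH eta vP nz lg0 lh0 lG0 lH0 _ _ etaN sum0.
move=> x_ v_ eta_ x_xs x_neq v_P eta_eta eta_N.
set Lk := fun k => [set i | submxrow (eta_ k) i != 0]%SET.
pose red k L := collection h G H I4 I1 (I2 :|: I5)%SET (I3 :|: I6)%SET L
  (v_^~ k) (x_ k) (fun i => submxrow (eta_ k) i).
(* [Lk k] takes finitely many values, so each can be treated separately. *)
suff dep L : \forall k \near \oo, Lk k = L -> ~~ free (red k L).
  by apply: filterS (filter_forall _ dep) => k depk; exact: (depk (Lk k)).
apply: near_infty_subseq => phi phioo; apply: contrapT => no_k.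
have {no_k} LkL k : Lk (phi k) = L /\ free (red (phi k) L).
  have [LL|LL] := eqVneq (Lk (phi k)) L; last first.
    by exfalso; apply: no_k; exists k => /eqP; rewrite (negbTE LL).
  split=> //; apply: contrapT => /negP nf; apply: no_k.
  by exists k.
(* Blocks in [L] may also vanish in the limit, which RCRCQ permits: it asks for normals, not for
   nonzero ones. *)
have eta0 i : i \notin L -> submxrow eta i = 0.
  move=> iL; have := submxrow_cvg (i := i) (cvg_comp _ _ phioo eta_eta).
  have -> : (fun k => submxrow ((eta_ \o phi) k) i) = fun=> 0.
    apply/funext => k /=; have [Lphi _] := LkL k.
    by move: iL; rewrite -Lphi inE negbK => /eqP.
  move=> /(cvg_unique (@norm_hausdorff _ _)); apply; exact: cvg_cst.
have := rcrcq I4 I5 I6 L sI4 sI5 sI6 v (fun i => submxrow eta i) vP _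
  (x_ \o phi) (fun i => v_ i \o phi) (fun i k => submxrow (eta_ (phi k)) i)
  (cvg_comp _ _ phioo x_xs) _ _ _.
case=> [||||N _ /(_ N (leqnn N))].
- by move=> i _; exact: limiting_normal_cone_prod.
- by move=> k; exact: x_neq.
- move=> i /v_P[vk vc]; split=> [k|]; first exact: vk.
  exact: cvg_comp _ _ phioo vc.
- move=> i _; split=> [k|]; first exact: eta_N.
  exact: submxrow_cvg (cvg_comp _ _ phioo eta_eta).
apply/eqP; rewrite ltn_eqF//.
have [_ free_red] := LkL N.
(* The size of the reduced family separates the two ranks: strictly above the one at [xs], at most
   the one at [x_ (phi N)]. *)
apply: (@leq_trans (size (red (phi N) L))).
  apply: leq_ltn_trans (dimvS (span_collection_basis _ _ _ _ _ _ span_basis)) _.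
  set red_xs := collection _ _ _ _ _ _ _ _ _ _ _.
  have -> : size (red (phi N) L) = size red_xs.
    by rewrite /red /red_xs /collection /gradients !(size_cat, size_map).
  (* A span of dimension equal to the size would mean a free family at [xs], forcing all multipliers
     to be zero. *)
  rewrite ltn_neqAle dim_span andbT; apply/negP => fr; apply: nz.
  exact: free_collection_eq0 fr eta0 lg0 lh0 lG0 lH0 sum0.
rewrite -(eqP free_red) dimvS//; apply/sub_span/collection_subset.
- exact: finset.subsetT.
- exact: finset.setSU.
- exact: finset.setSU.
Qed.
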